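(* Let $(\Omega,\mu)$ be a measure space, where $\mu$ is a finite (positive) measure on $\Omega$ with mass $\mu(\Omega)>0$, and let $f:\Omega\to\mathbb{R}$ be integrable with respect to $\mu$. Then there exist points $x_0,x_1\in\Omega$ and a real number $\lambda\in[0,1]$ such that $$\int_\Omega f\,d\mu \;=\; \mu(\Omega)\,\bigl(\lambda f(x_0)+(1-\lambda) f(x_1)\bigr),$$ that is, $\frac{1}{\mu(\Omega)}\int_\Omega f\,d\mu$ is a convex combination of $f(x_0)$ and $f(x_1)$.
   Context: The $\sigma$-algebra on $\Omega$ is left implicit in the notation $(\Omega,\mu)$. No topology, compactness or connectedness is assumed on $\Omega$, and no continuity is assumed on $f$. *)

(* Defs.v *)
From mathcomp Require Export all_boot all_order all_algebra.
From mathcomp Require Export all_classical all_reals all_analysis.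

Set Implicit Arguments.
Unset Strict Implicit.
Unset Printing Implicit Defensive.

(* Main.v *)
(** Writing [c] for the mean of [f], one cannot have [f > c] everywhere:
    [f - c] would be a positive function with zero integral on a space of
    positive mass. Hence [f] takes a value below [c] and, by symmetry, a value
    above [c], and [c] lies on the segment between them. *)
Require Import Defs.
From mathcomp Require Import all_boot all_order all_algebra.
From mathcomp Require Import all_classical all_reals all_analysis.
From mathcomp Require Import ring.

Import Order.TTheory GRing.Theory Num.Theory.
Local Open Scope classical_set_scope.
Local Open Scope ring_scope.
Local Open Scope ereal_scope.

(** Since [g] is its own absolute value, zero integral forces [g] to vanish almost everywhere; as it
    vanishes nowhere, the negligible exceptional set is the whole space. *)
Lemma measure0_of_integral_gt0_eq0 (R : realType) (d : measure_display)
    (T : measurableType d) (mu : {measure set T -> \bar R}) (g : T -> \bar R) :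
  mu.-integrable setT g -> (forall x, 0 < g x) ->
  \int[mu]_x g x = 0 -> mu setT = 0.
Proof.
move=> /measurable_int mg g_gt0 int0.
have /(ae_eq_integral_abs mu measurableT mg) : \int[mu]_x `|g x| = 0.
  by rewrite -int0; apply: eq_integral => x _; rewrite gee0_abs// ltW.
move=> /negligibleP; rewrite (_ : ~` _ = setT).
  by apply; exact: measurableT.
apply/seteqP; split=> // x _ /= /(_ Logic.I) gx0.
by have := g_gt0 x; rewrite gx0 ltxx.
Qed.

(** Fixing [c] by a product equation avoids division in [\bar R] and lets the lemma be reused for
    [- f] and [- c]. *)
Lemma exists_le_mean (R : realType) (d : measure_display)
    (T : measurableType d) (mu : {finite_measure set T -> \bar R})
    (f : T -> R) (c : R) :
  0 < mu setT -> mu.-integrable setT (EFin \o f) ->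
  \int[mu]_x (f x)%:E = mu setT * c%:E -> exists x, (f x <= c)%R.
Proof.
move=> mu_gt0 f_int intf; apply/not_existsP => f_gt.
have c_int : mu.-integrable setT (EFin \o cst c).
  exact: finite_measure_integrable_cst.
suff mu0 : mu setT = 0 by rewrite mu0 ltxx in mu_gt0.
apply: (@measure0_of_integral_gt0_eq0 _ _ _ _ (fun x => (f x)%:E - c%:E)).
- exact: (integrableB measurableT f_int c_int).
- by move=> x; rewrite -EFinB lte_fin subr_gt0 ltNge; apply/negP/f_gt.
- rewrite (integralB_EFin measurableT f_int c_int) intf (integral_cst _ measurableT c%:E).
  by rewrite muleC subee// fin_numM// fin_num_measure.
Qed.

Lemma exists_convex_comb (R : realFieldType) (a b c : R) :
  (a <= c <= b ->
   exists l : R, 0 <= l <= 1 /\ c = l * a + (1 - l) * b)%R.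
Proof.
move=> /andP[ac cb]; have [ab|ba] := ltP a b; last first.
  (* Here [b <= a] squeezes [a], [c] and [b] to one value, so any weight would do. *)
  exists 1%R; rewrite ler01 lexx; split=> //.
  by rewrite mul1r subrr mul0r addr0; apply/le_anti; rewrite ac (le_trans cb).
have ba_gt0 : (0 < b - a)%R by rewrite subr_gt0.
(* The weight is the solution for [l] of the linear equation [c = l * a + (1 - l) * b]. *)
exists ((b - c) / (b - a))%R; split; last by field; rewrite gt_eqF.
rewrite divr_ge0 ?subr_ge0// ?(ltW ab)//= ler_pdivrMr// mul1r.
by rewrite lerD2l lerN2.
Qed.

Theorem proposition2p2 (R : realType) (d : measure_display)
    (Omega : measurableType d) (mu : {finite_measure set Omega -> \bar R})
    (f : Omega -> R) (mu_gt0 : 0 < mu setT)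
    (f_int : mu.-integrable setT (EFin \o f)) :
  exists (x0 x1 : Omega) (lambda : R),
    (0 <= lambda <= 1)%R /\
    \int[mu]_x (f x)%:E =
      mu setT * (lambda * f x0 + (1 - lambda) * f x1)%:E.
Proof.
have mu_fin : mu setT \is a fin_num by exact: fin_num_measure.
have if_fin : \int[mu]_x (f x)%:E \is a fin_num.
  exact: integrable_fin_num.
(* Integral and mass are both finite, so [fine] loses nothing, and the positive mass makes this a
   genuine quotient. *)
pose c : R := (fine (\int[mu]_x (f x)%:E) / fine (mu setT))%R.
have intf : \int[mu]_x (f x)%:E = mu setT * c%:E.
  rewrite -(fineK mu_fin) -EFinM /c mulrC divfK ?fineK//.
  by rewrite gt_eqF// fine_gt0// mu_gt0 ltey_eq mu_fin.
have [x0 f_x0] := exists_le_mean _ _ _ _ _ _ mu_gt0 f_int intf.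
(* The upper point for [f] is a lower point for [- f], whose mean is [- c]. *)
have [x1 f_x1] : exists x, (- f x <= - c)%R.
  apply: (@exists_le_mean _ _ _ mu (fun x => - f x)%R) => //.
    exact: (integrableN f_int).
  rewrite EFinN muleN -intf.
  by under eq_integral do rewrite EFinN; rewrite integralN// integrable_add_def.
have [|l [l01 cE]] := exists_convex_comb _ (f x0) (f x1) c.
  by rewrite f_x0 -lerN2.
by exists x0, x1, l; rewrite -cE.
Qed.
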